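(* For all integers $n\geq 0$, $d_2(11n+7) \equiv 0 \pmod{11}$.
   Context: For each integer $k\geq 1$, the numbers $d_k(n)$ (the partition numbers obtained by summing the links of $k$-elongated plane partition diamonds of length $n$) are defined by the generating function $\sum_{n\geq 0} d_k(n)q^n = \frac{f_2^k}{f_1^{3k+1}}$, where $f_r = \prod_{i\geq 1}(1-q^{ri})$. *)

(* Defs.v *)
From mathcomp Require Import all_boot all_order all_algebra.
Set Implicit Arguments. Unset Strict Implicit. Unset Printing Implicit Defensive.
Import GRing.Theory Num.Theory.
Local Open Scope ring_scope.

(* Truncation (valid modulo q^(N+1)) of f_r = prod_{i>=1} (1 - q^(r i)). *)
Definition f_trunc (r N : nat) : {poly int} :=
  \prod_(1 <= i < N.+1) (1 - 'X^(r * i)).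

(* Truncation (valid modulo q^(N+1)) of 1/f_1 = prod_{i>=1} 1/(1 - q^i)
   = prod_{i>=1} sum_{j>=0} q^(i j). *)
Definition inv_f1_trunc (N : nat) : {poly int} :=
  \prod_(1 <= i < N.+1) \sum_(0 <= j < N.+1) 'X^(i * j).

Definition d (k n : nat) : int :=
  ((f_trunc 2 n) ^+ k * (inv_f1_trunc n) ^+ (3 * k + 1))`_n.

(* Main.v *)
Require Import Defs.
From mathcomp Require Import all_boot all_order all_algebra.
From mathcomp Require Import zify ring.
Set Implicit Arguments. Unset Strict Implicit. Unset Printing Implicit Defensive.
Import Order.TTheory GRing.Theory Num.Theory.
Local Open Scope ring_scope.

(* Modulo 11, f_2^2 / f_1^7 = f_1^4 f_2^2 / f_1(q^11), so it suffices that the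
   coefficients of f_1^4 f_2^2 at the exponents 11 m + 7 vanish modulo 11.
   Put G(q) = sum_{k in Z} (-1)^k (3 k + 1) q^(3 k^2 + 2 k).  Then
   G = f_2^5 / f_1^2, and hence G(q) G(-q) = f_2^4 f_4^2 is f_1^4 f_2^2 in q^2.
   A term of G(q) G(-q) at q^(22 m + 14) comes from integers k, l with
   (3 k + 1)^2 + (3 l + 1)^2 = 66 m + 44; since -1 is not a square modulo 11,
   11 divides 3 k + 1 and 3 l + 1.

   For G = f_2^5 / f_1^2, let phi = sum (-1)^j q^(j^2) = f_1^2 / f_2 (Gauss).
   Jacobi's f_2^3 times Euler's f_2 and the product G phi are both theta series
   over the Eisenstein lattice (norms x^2 + 3 y^2, with x = 3 k + 1), and
   rotating by a cube root of unity shows f_2^4 = G phi. *)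

(** * Congruences modulo a power of X, and Gaussian binomials *)

Section CongruenceModXn.
Variable K : nat.
Implicit Types p q : {poly int}.

(** Congruence modulo 'X^K with an explicit quotient, so that compatibility proofs reduce to [ring].
    Identities between power series become such congruences between truncations. *)
Definition eqX p q := exists r, p = q + 'X^K * r.

Lemma eqX_refl p : eqX p p.
Proof. by exists 0; rewrite mulr0 addr0. Qed.

Lemma eqX_sym p q : eqX p q -> eqX q p.
Proof. by case=> r ->; exists (- r); ring. Qed.

Lemma eqX_trans q p r : eqX p q -> eqX q r -> eqX p r.
Proof. by case=> a -> [b ->]; exists (a + b); ring. Qed.

Lemma eqXD p p' q q' : eqX p p' -> eqX q q' -> eqX (p + q) (p' + q').
Proof. by case=> a -> [b ->]; exists (a + b); ring. Qed.

Lemma eqXM p p' q q' : eqX p p' -> eqX q q' -> eqX (p * q) (p' * q').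
Proof.
by case=> a -> [b ->]; exists (p' * b + a * q' + 'X^K * a * b); ring.
Qed.

Lemma eqXMl p q q' : eqX q q' -> eqX (p * q) (p * q').
Proof. exact/eqXM/eqX_refl. Qed.

Lemma eqXMr p q q' : eqX q q' -> eqX (q * p) (q' * p).
Proof. by move=> h; apply: eqXM => //; apply: eqX_refl. Qed.

Lemma eqX_exp m p q : eqX p q -> eqX (p ^+ m) (q ^+ m).
Proof.
move=> h; elim: m => [|m IH]; first exact: eqX_refl.
by rewrite !exprS; apply: eqXM.
Qed.

Lemma eqX_sum (I : Type) (s : seq I) (F H : I -> {poly int}) :
  (forall i, eqX (F i) (H i)) -> eqX (\sum_(i <- s) F i) (\sum_(i <- s) H i).
Proof.
move=> FH; apply: (big_ind2 (fun p q => eqX p q)) => //; first exact: eqX_refl.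
by move=> p p' q q'; apply: eqXD.
Qed.

Lemma eqX_exp0 m p q : (K <= m)%N -> eqX ('X^m * p) ('X^m * q).
Proof.
by move=> Km; exists ('X^((m - K)%N) * (p - q)); rewrite -(subnKC Km) addKn exprD; ring.
Qed.

Lemma eqX_coefP p q : eqX p q <-> forall i, (i < K)%N -> p`_i = q`_i.
Proof.
split=> [[r ->] i iK|h]; first by rewrite coefD coefXnM iK addr0.
exists (drop_poly K (p - q)).
have t0 : take_poly K (p - q) = 0.
  apply/polyP=> i; rewrite coef_take_poly coef0; case: ifP => // iK.
  by rewrite coefB h // subrr.
rewrite -[p in LHS](subrK q) -[X in X + q](poly_take_drop K) t0 add0r; ring.
Qed.

(** A polynomial with constant term 1 is a unit modulo 'X^K: coefficient i of p a is a_i plus terms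
    in earlier coefficients of a, hence the strong induction. *)
Lemma eqX_mulI p a b : p`_0 = 1 -> eqX (p * a) (p * b) -> eqX a b.
Proof.
move=> p0 /eqX_coefP h; apply/eqX_coefP; elim/ltn_ind => i IH iK.
have := h i iK; rewrite !coefM !big_ord_recl /= p0 !mul1r subn0.
have E : \sum_(j < i) p`_(bump 0 j) * a`_(i - bump 0 j)
       = \sum_(j < i) p`_(bump 0 j) * b`_(i - bump 0 j).
  by apply: eq_bigr => j _; rewrite IH //; rewrite /bump /=; have := ltn_ord j; lia.
by rewrite E => /addIr.
Qed.

End CongruenceModXn.

Lemma f_trunc0 r m : (0 < r)%N -> (f_trunc r m)`_0 = 1.
Proof.
move=> r0; rewrite -horner_coef0 /f_trunc horner_prod big_nat big1 // => i /andP[i1 _].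
by rewrite !hornerE /= expr0n muln_eq0 !eqn0Ngt r0 i1 subr0.
Qed.

(** Factors of index at least K are 1 modulo 'X^K. *)
Lemma f_trunc_stable K r m : (0 < r)%N -> (K <= m.+1)%N ->
  eqX K (f_trunc r m) (f_trunc r K.-1).
Proof.
move=> r0 Km; rewrite /f_trunc (big_cat_nat (n := K.-1.+1)) //=; last by lia.
rewrite -[X in eqX _ _ X]mulr1; apply: eqXMl; rewrite big_nat.
apply: (big_ind (fun p => eqX K p 1)) => [|p q hp hq|i /andP[Ki _]].
- exact: eqX_refl.
- by rewrite -[1]mulr1; apply: eqXM.
- exists (- 'X^((r * i - K)%N)); rewrite mulrN -exprD subnKC //; nia.
Qed.

Lemma f_trunc_eqX K r m m' : (0 < r)%N -> (K <= m.+1)%N -> (K <= m'.+1)%N ->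
  eqX K (f_trunc r m) (f_trunc r m').
Proof.
move=> r0 Km Km'; apply: (@eqX_trans _ (f_trunc r K.-1)); first exact: f_trunc_stable.
by apply/eqX_sym/f_trunc_stable.
Qed.

Section GaussBinomial.
Variables (R : comNzRingType) (q : R).

(** The q-Pascal rule gives Gaussian binomials without division. The subtraction n' - k' truncates
    only when n' < k', where [gbin n' k'] vanishes. *)
Fixpoint gbin n k : R :=
  match n, k with
  | _, 0 => 1
  | 0, _.+1 => 0
  | n'.+1, k'.+1 => gbin n' k'.+1 + q ^+ (n' - k') * gbin n' k'
  end.

Arguments gbin n k : simpl never.

Lemma gbin0 n : gbin n 0 = 1. Proof. by case: n. Qed.

Lemma gbinS n k : gbin n.+1 k.+1 = gbin n k.+1 + q ^+ (n - k) * gbin n k.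
Proof. by []. Qed.

Lemma gbin_small n k : (n < k)%N -> gbin n k = 0.
Proof.
elim: n k => [|n IH] [|k] // nk; rewrite gbinS !IH ?mulr0 ?addr0 //; lia.
Qed.

(** The splitting 1 - q^(a+b+2) = (1 - q^(b+1)) + q^(b+1) (1 - q^(a+1)) matches the two terms of the
    Pascal rule. *)
Lemma gbin_prod a b :
  gbin (a + b) a * (\prod_(1 <= i < a.+1) (1 - q ^+ i) *
    \prod_(1 <= i < b.+1) (1 - q ^+ i)) = \prod_(1 <= i < (a + b).+1) (1 - q ^+ i).
Proof.
elim: a b => [|a IHa] b; first by rewrite gbin0 mul1r big_geq // mul1r.
elim: b => [|b IHb].
  have := IHa 0; rewrite !addn0 gbinS (@gbin_small a a.+1) // subnn expr0.
  rewrite (@big_geq _ _ _ 1 1) // => h.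
  rewrite (big_nat_recr a.+1) //=.
  set P := \prod_(1 <= i < a.+1) _ in h *; rewrite -[P in RHS]h; ring.
rewrite addSn gbinS addnS.
have -> : ((a + b).+1 - a = b.+1)%N by lia.
have := IHa b.+1; rewrite addnS => h1; have := IHb; rewrite addSn => h2.
rewrite (big_nat_recr (a + b).+2) //= mulrDl.
rewrite [X in _ * (_ * X)](big_nat_recr b.+1) //=.
set u := gbin (a + b).+1 a.+1 in h2 *; set v := gbin (a + b).+1 a in h1 *.
set A1 := \prod_(1 <= i < a.+2) _ in h2 *.
set B0 := \prod_(1 <= i < b.+1) _ in h2 *.
have A1E : A1 = \prod_(1 <= i < a.+1) (1 - q ^+ i) * (1 - q ^+ a.+1).
  by rewrite /A1 big_nat_recr.
have B1E : \prod_(1 <= i < b.+2) (1 - q ^+ i) = B0 * (1 - q ^+ b.+1).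
  by rewrite /B0 (big_nat_recr b.+1).
rewrite B1E in h1.
set T := \prod_(1 <= i < (a + b).+2) _ in h1 h2 *.
have e : q ^+ (a + b).+2 = q ^+ a.+1 * q ^+ b.+1 by rewrite -exprD; congr (_ ^+ _); lia.
rewrite e.
transitivity (u * (A1 * B0) * (1 - q ^+ b.+1) +
   q ^+ b.+1 * (1 - q ^+ a.+1) *
   (v * (\prod_(1 <= i < a.+1) (1 - q ^+ i) * (B0 * (1 - q ^+ b.+1))))).
  by rewrite A1E B1E; ring.
rewrite h1 h2; ring.
Qed.

(** The q-binomial theorem, source of both the triple product and Jacobi's cube identity. *)
Lemma gauss_binomial n : \prod_(i < n) ('X - (q ^+ i)%:P) =
  \sum_(k < n.+1) ((-1) ^+ k * q ^+ 'C(k, 2) * gbin n k)%:P * 'X^(n - k) :> {poly R}.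
Proof.
elim: n => [|n IH]; first by rewrite big_ord0 big_ord1 gbin0 expr0 !mul1r.
rewrite big_ord_recr IH /= mulrBr.
rewrite [in X in _ = X]big_ord_recl.
rewrite [X in X * 'X]big_ord_recl mulrDl.
rewrite !gbin0 !subn0 !expr0 !mul1r -addrA; congr (_ + _).
  by rewrite -exprSr.
rewrite mulr_suml.
transitivity (\sum_(i < n.+1)
   ((-1) ^+ i.+1 * q ^+ 'C(i.+1, 2) * gbin n i.+1)%:P * 'X^(n - i)
  - \sum_(k < n.+1) ((-1) ^+ k * q ^+ 'C(k, 2) * gbin n k)%:P * 'X^(n - k) * (q ^+ n)%:P).
  rewrite mulr_suml; congr (_ - _).
  rewrite [RHS]big_ord_recr /= gbin_small // mulr0 mul0r addr0.
  apply: eq_bigr => i _; rewrite /bump /= add1n -[LHS]mulrA -exprSr.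
  by congr (_ * 'X^_); have := ltn_ord i; lia.
rewrite -sumrB; apply: eq_bigr => i _; rewrite lift0 subSS gbinS.
rewrite [X in _ - X]mulrAC -mulrBl -polyCM -polyCB; congr (_%:P * _).
have -> : q ^+ 'C(i.+1, 2) = q ^+ 'C(i, 2) * q ^+ i by rewrite -exprD binS bin1 addnC.
have -> : q ^+ n = q ^+ i * q ^+ (n - i) by rewrite -exprD subnKC // -ltnS.
rewrite exprS; ring.
Qed.

End GaussBinomial.

(** * Theta series as infinite products *)

Definition sym_range (n : nat) : seq int := [seq k%:Z - n%:Z | k <- iota 0 (2 * n + 1)].

Lemma mem_sym_range n (x : int) : (x \in sym_range n) = (`|x| <= n)%N.
Proof.
apply/mapP/idP => [[k]|xn]; first by rewrite mem_iota => ? ->; lia.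
by exists (absz (x + n%:Z)); [rewrite mem_iota|]; lia.
Qed.

Lemma sym_range_uniq n : uniq (sym_range n).
Proof. by rewrite map_inj_uniq ?iota_uniq // => x y; lia. Qed.

Lemma big_sym_range (R : nmodType) n (F : int -> R) :
  \sum_(j <- sym_range n) F j = \sum_(k < 2 * n + 1) F (k%:Z - n%:Z).
Proof.
by rewrite -(big_mkord xpredT (fun k : nat => F (k%:Z - n%:Z))) big_map /index_iota subn0.
Qed.

Lemma f_trunc_exp r n : f_trunc r n = \prod_(1 <= i < n.+1) (1 - 'X^r ^+ i) :> {poly int}.
Proof. by apply: eq_bigr => i _; rewrite exprM. Qed.

(** For large indices [gbin_prod] reads f_r^2 gbin = f_r, and one f_r cancels. *)
Lemma gbin_limit K r n a b : (0 < r)%N -> (K <= n)%N -> (K <= a)%N -> (K <= b)%N ->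
  eqX K (f_trunc r n * gbin 'X^r (a + b) a) 1.
Proof.
move=> r0 Kn Ka Kb; apply: (@eqX_mulI _ (f_trunc r n)); first exact: f_trunc0.
rewrite mulr1; apply: (@eqX_trans _ (f_trunc r (a + b))); last first.
  by apply: f_trunc_eqX => //; lia.
rewrite [f_trunc r (a + b)]f_trunc_exp -gbin_prod -!f_trunc_exp mulrA mulrC.
by apply: eqXMl; apply: eqXM; apply: f_trunc_eqX => //; lia.
Qed.

(** Termwise limit: a term with e j < K has both binomial indices large, so [gbin_limit] applies;
    any other term is 0 modulo 'X^K on both sides. *)
Lemma theta_limit K n r (c : int -> {poly int}) (e : int -> nat) (g : int -> nat * nat) :
  (0 < r)%N -> (K <= n)%N ->
  (forall j, (e j < K)%N -> (K <= (g j).1)%N /\ (K <= (g j).2)%N) ->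
  eqX K (f_trunc r n * \sum_(j <- sym_range n) c j *
          gbin 'X^r ((g j).1 + (g j).2) (g j).1 * 'X^(e j))
        (\sum_(j <- sym_range n) c j * 'X^(e j)).
Proof.
move=> r0 Kn ge; rewrite mulr_sumr; apply: eqX_sum => j.
have [/ge[g1 g2]|Ke] := ltnP (e j) K; last first.
  by rewrite mulrA ![_ * 'X^_]mulrC; apply: eqX_exp0.
rewrite mulrA; apply: eqXMr; rewrite mulrCA -[X in eqX _ _ X]mulr1.
by apply: eqXMl; apply: gbin_limit.
Qed.

Lemma sgn_dist n k : (-1) ^+ `|k%:Z - n%:Z|%N = (-1) ^+ (n + k) :> {poly int}.
Proof. by rewrite -[LHS]signr_odd -[RHS]signr_odd; congr (_ ^+ nat_of_bool _); lia. Qed.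

Lemma bin2_double k : ('C(k, 2) * 2 = k * k.-1)%N.
Proof. by elim: k => [|[|k] IH] //; rewrite binS bin1 mulnDl IH /=; nia. Qed.

Lemma prod_opp_Xn r n :
  \prod_(0 <= i < n) (- 'X^(r * i)) = (-1) ^+ n * 'X^(r * 'C(n, 2)) :> {poly int}.
Proof.
elim: n => [|n IH]; first by rewrite big_geq // muln0 mulr1.
by rewrite big_nat_recr //= IH binS bin1 exprS mulnDr exprD; ring.
Qed.

(** Finite form of Jacobi's triple product: the q-binomial theorem with q = 'X^(t + u) and 2 n
    factors, evaluated at a power of 'X. The exponent is given doubled to avoid halves. *)
Lemma finite_triple_product t u (e : int -> nat) n : (0 < n)%N ->
  (forall j, 2 * (e j)%:Z = t%:Z * j * (j + 1) + u%:Z * j * (j - 1)) ->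
  (\prod_(i < n) (1 - 'X^((t + u) * i + t))) * (\prod_(i < n) (1 - 'X^((t + u) * i + u))) =
  \sum_(j <- sym_range n) (-1) ^+ `|j|%N *
     gbin 'X^(t + u) (2 * n) (absz (n%:Z + j)) * 'X^(e j) :> {poly int}.
Proof.
move=> n0 eE; set r := (t + u)%N.
(* At x = 'X^s the first n factors are - 'X^(r i) (1 - 'X^(r (n - 1 - i) + u)) and the last n are
   'X^s (1 - 'X^(r i + t)); C collects the monomials. *)
pose s := (r * n.-1 + u)%N; pose C := (r * 'C(n, 2) + s * n)%N.
have := congr1 (fun p => p.['X^s]) (gauss_binomial ('X^r : {poly int}) (2 * n)).
rewrite /= horner_prod mul2n -addnn big_split_ord /= horner_sum => H.
have Hl : \prod_(i < n) ('X - (('X^r : {poly int}) ^+ i)%:P).['X^s] *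
   \prod_(i < n) ('X - (('X^r : {poly int}) ^+ (n + i))%:P).['X^s] =
   (-1) ^+ n * 'X^C * ((\prod_(i < n) (1 - 'X^(r * i + t))) * (\prod_(i < n) (1 - 'X^(r * i + u)))).
  have -> : \prod_(i < n) ('X - (('X^r : {poly int}) ^+ i)%:P).['X^s] =
     (-1) ^+ n * 'X^(r * 'C(n, 2)) * \prod_(i < n) (1 - 'X^(r * i + u)).
    rewrite [X in _ = _ * X](reindex_inj rev_ord_inj) /=.
    rewrite -prod_opp_Xn big_mkord -big_split /=; apply: eq_bigr => i _.
    rewrite !hornerE -exprM mulrBr mulr1 mulNr opprK -exprD addrC; congr (_ + 'X^_).
    by rewrite /s; have := ltn_ord i; nia.
  have -> : \prod_(i < n) ('X - (('X^r : {poly int}) ^+ (n + i))%:P).['X^s] =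
     'X^(s * n) * \prod_(i < n) (1 - 'X^(r * i + t)).
    have -> : 'X^(s * n) = \prod_(i < n) 'X^s :> {poly int}.
      by rewrite prodr_const card_ord -exprM.
    rewrite -big_split /=.
    apply: eq_bigr => i _; rewrite !hornerE -exprM mulrBr mulr1 -exprD.
    by congr (_ - 'X^_); rewrite /s /r; nia.
  rewrite /C exprD; ring.
rewrite {}Hl in H.
apply: (@mulfI _ ((-1) ^+ n * 'X^C)).
  by rewrite mulf_neq0 ?signr_eq0 // -size_poly_eq0 size_polyXn.
rewrite {}H big_sym_range mul2n -addnn addn1 mulr_sumr; apply: eq_bigr => k _.
rewrite hornerM hornerC hornerXn sgn_dist -!exprM.
have -> : absz (n%:Z + (k%:Z - n%:Z)) = k by lia.
have -> : (-1) ^+ (n + k) = (-1) ^+ n * (-1) ^+ k :> {poly int} by rewrite exprD.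
have sq : (-1) ^+ n * (-1) ^+ n = 1 :> {poly int} by rewrite -expr2 sqrr_sign.
transitivity (((-1) ^+ n * (-1) ^+ n) *
  ((-1) ^+ k * gbin 'X^r (n + n) k * ('X^C * 'X^(e (k%:Z - n%:Z)))) : {poly int}); last by ring.
suff -> : 'X^C * 'X^(e (k%:Z - n%:Z)) =
    'X^(r * 'C(k, 2)) * 'X^(s * (n + n - k)) :> {poly int} by rewrite sq; ring.
rewrite -!exprD; congr 'X^_.
have := eE (k%:Z - n%:Z); have := bin2_double k; have := bin2_double n.
have := ltn_ord k; rewrite /C /s /r.
move: (e _) => E; case: n n0 {C s sq eE} k => // n _ k /=.
move: (nat_of_ord k) => {}k kn.
have [m nkm] : exists m, (n.+1 + n.+1 = k + m)%N by exists (n.+1 + n.+1 - k)%N; lia.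
rewrite nkm addKn; move: 'C(n.+1, 2) 'C(k, 2) => A B hA hB hE.
have {hB} hB : B%:Z * 2 = k%:Z * (k%:Z - 1) by case: (k) hB => [|i]; lia.
have {hA} hA : A%:Z * 2 = (n%:Z + 1) * n%:Z by lia.
have kE : k%:Z = 2 * n%:Z + 2 - m%:Z by lia.
suff : 2 * (r%:Z * A%:Z + (r%:Z * n%:Z + u%:Z) * (n%:Z + 1) + E%:Z) =
       2 * (r%:Z * B%:Z + (r%:Z * n%:Z + u%:Z) * m%:Z) by rewrite /r; lia.
transitivity (r%:Z * (A%:Z * 2) + 2 * (r%:Z * n%:Z + u%:Z) * (n%:Z + 1) + 2 * E%:Z).
  by ring.
rewrite hA hE.
transitivity (r%:Z * (B%:Z * 2) + 2 * (r%:Z * n%:Z + u%:Z) * m%:Z); last by ring.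
by rewrite hB kE /r PoszD intS; ring.
Qed.

(* Value (zero) and derivative at x = q^n of the q-binomial theorem for
   prod_(i <= 2 n) (x - q^i), where q = X^r. *)
Lemma finite_jacobi_cube r (e : int -> nat) n :
  (forall j, 2 * (e j)%:Z = r%:Z * j * (j + 1)) ->
  2 * f_trunc r n ^+ 2 =
  \sum_(k < (2 * n + 1).+1) (-1) ^+ `|n%:Z - k%:Z|%N * (2 * (n%:Z - k%:Z) + 1)%:~R *
     gbin 'X^r (2 * n + 1) k * 'X^(e (n%:Z - k%:Z)).
Proof.
move=> eE; set m := (2 * n + 1)%N; pose q := 'X^r : {poly int}.
pose c k := (-1) ^+ k * q ^+ 'C(k, 2) * gbin q m k.
have nm : (n < m)%N by rewrite /m; lia.
(* The product without its root q^n, so that its value at q^n is the derivative of the full product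
   there. *)
pose Q := \prod_(i < m | i != Ordinal nm) ('X - (q ^+ i)%:P).
have GB := gauss_binomial q m.
rewrite (bigD1 (Ordinal nm)) //= -/Q in GB.
have E0 : \sum_(k < m.+1) c k * q ^+ (n * (m - k)) = 0.
  have := congr1 (horner^~ (q ^+ n)) GB; rewrite /= horner_sum !hornerE subrr mul0r => {2}->.
  by apply: eq_bigr => k _; rewrite hornerM hornerC hornerXn exprM.
have E1 : q ^+ n * Q.[q ^+ n] = \sum_(k < m.+1) c k * (m - k)%:R * q ^+ (n * (m - k)).
  have := congr1 (fun p => q ^+ n * p^`().[q ^+ n]) GB.
  rewrite /= derivM derivXsubC mul1r hornerD hornerM hornerXsubC subrr mul0r addr0 => ->.
  rewrite raddf_sum horner_sum mulr_sumr; apply: eq_bigr => k _.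
  rewrite [X in X.[_]]derivM derivC mul0r add0r derivXn hornerM hornerC hornerMn hornerXn.
  case: (m - k)%N => [|i]; first by rewrite !mulr0n mulr0 !mulr0 mul0r.
  by rewrite /= -mulr_natl [q ^+ (n * _)]exprM exprS /c; ring.
(* The factors below n and those above n each yield one f_r, up to sign and a monomial. *)
have QE : Q.[q ^+ n] = (-1) ^+ n * 'X^(r * 'C(n, 2) + r * n * n) * f_trunc r n ^+ 2.
  pose F i : {poly int} := q ^+ n - q ^+ i.
  have -> : Q.[q ^+ n] = (\prod_(0 <= i < n) F i) * \prod_(n.+1 <= i < m) F i.
    rewrite /Q horner_prod.
    transitivity (\prod_(i < m | i != n :> nat) F i).
      by apply: eq_bigr => i _; rewrite !hornerE.
    rewrite -(big_mkord (fun i => i != n) F) (big_cat_nat (n := n)) //=; last exact: ltnW.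
    congr (_ * _).
      rewrite big_nat_cond [RHS]big_nat_cond; apply: eq_bigl => i.
      by rewrite andbT; case: (ltngtP i n).
    rewrite big_ltn_cond // eqxx /= big_nat_cond [RHS]big_nat_cond.
    by apply: eq_bigl => i; rewrite andbT; case: (ltngtP i n) => //= _; rewrite ?andbT.
  have -> : \prod_(n.+1 <= i < m) F i = 'X^(r * n * n) * f_trunc r n.
    have -> : 'X^(r * n * n) = \prod_(1 <= i < n.+1) q ^+ n :> {poly int}.
      by rewrite prodr_const_nat subn1 -!exprM ?mulnA.
    have -> : m = (n + n.+1)%N by rewrite /m; lia.
    rewrite -{1}[n.+1]add0n big_addn addnK /f_trunc -big_split /= big_add1 /=.
    apply: eq_bigr => i _.
    by rewrite mulrBr mulr1 /F /q -!exprM -exprD; congr (_ - 'X^_); lia.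
  have -> : \prod_(0 <= i < n) F i = (-1) ^+ n * 'X^(r * 'C(n, 2)) * f_trunc r n.
    rewrite -prod_opp_Xn /f_trunc big_add1 /= [X in _ * X]big_nat_rev /= -big_split /=.
    rewrite !big_nat; apply: eq_bigr => i /andP[_ ni].
    rewrite mulrBr mulr1 mulNr opprK -exprD /F /q -!exprM addrC; congr (_ + 'X^_).
    by rewrite -mulnDr; congr (_ * _)%N; lia.
  by rewrite exprD; ring.
have sq : (-1) ^+ n * (-1) ^+ n = 1 :> {poly int} by rewrite -expr2 sqrr_sign.
apply: (@mulfI _ ((-1) ^+ n * 'X^(r * n + (r * 'C(n, 2) + r * n * n)))).
  by rewrite mulf_neq0 ?signr_eq0 // -size_poly_eq0 size_polyXn.
transitivity (2 * (q ^+ n * Q.[q ^+ n])).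
  by rewrite QE /q -exprM exprD; ring.
(* Subtracting m times the vanishing sum turns the weight 2 (m - k) into 2 (m - k) - m = 2 (n - k) +
   1. *)
have -> : 2 * (q ^+ n * Q.[q ^+ n]) =
  2 * (q ^+ n * Q.[q ^+ n]) - m%:R * \sum_(k < m.+1) c k * q ^+ (n * (m - k)).
  by rewrite E0 mulr0 subr0.
rewrite E1 !mulr_sumr -sumrB.
apply: eq_bigr => k _; have km := ltn_ord k.
have -> : (-1) ^+ `|n%:Z - k%:Z|%N = (-1) ^+ n * (-1) ^+ k :> {poly int}.
  by rewrite distnC sgn_dist exprD.
suff -> : (-1) ^+ n * 'X^(r * n + (r * 'C(n, 2) + r * n * n)) *
   ((-1) ^+ n * (-1) ^+ k * (2 * (n%:Z - k%:Z) + 1)%:~R * gbin 'X^r m k *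
   'X^(e (n%:Z - k%:Z))) = (-1) ^+ k * (2 * (m - k)%:R - m%:R) * gbin q m k *
   (q ^+ 'C(k, 2) * q ^+ (n * (m - k))).
  by rewrite /c; ring.
have -> : (2 * (n%:Z - k%:Z) + 1)%:~R = 2 * (m - k)%:R - m%:R :> {poly int}.
  have -> : 2 * (n%:Z - k%:Z) + 1 = 2 * (m - k)%N%:Z - m%:Z by rewrite /m in km *; lia.
  by rewrite rmorphB rmorphM.
have -> : q ^+ 'C(k, 2) * q ^+ (n * (m - k)) =
   'X^(r * n + (r * 'C(n, 2) + r * n * n)) * 'X^(e (n%:Z - k%:Z)).
  rewrite /q -!exprM -!exprD; congr 'X^_.
  have hE := eE (n%:Z - k%:Z); have := bin2_double k; have := bin2_double n.
  have [l lE] : exists l, (2 * n + 1 = k + l)%N by exists (m - k)%N; rewrite subnKC // -ltnS.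
  have -> : (m - k = l)%N by rewrite -(addKn k l) -lE.
  move: (e _) hE 'C(n, 2) 'C(k, 2) => E hE A B hA hB.
  have {hB} hB : B%:Z * 2 = k%:Z * (k%:Z - 1) by case: (nat_of_ord k) hB => [|i]; lia.
  have {hA} hA : A%:Z * 2 = n%:Z * (n%:Z - 1) by case: (n) hA => [|i]; lia.
  have lE' : l%:Z = 2 * n%:Z + 1 - k%:Z by lia.
  suff : 2 * (r%:Z * B%:Z + r%:Z * (n%:Z * l%:Z)) =
     2 * (r%:Z * n%:Z + (r%:Z * A%:Z + r%:Z * n%:Z * n%:Z) + E%:Z) by lia.
  transitivity (r%:Z * (B%:Z * 2) + 2 * r%:Z * n%:Z * l%:Z); first by ring.
  transitivity (2 * r%:Z * n%:Z + r%:Z * (A%:Z * 2) +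
    2 * r%:Z * n%:Z * n%:Z + 2 * E%:Z); last by ring.
  by rewrite hA hB hE lE'; ring.
suff aux (a b z u v w : {poly int}) :
    a * a = 1 -> a * v * (a * b * z * u * w) = b * z * u * (v * w).
  exact: aux.
by move=> aa; rewrite -[RHS]mul1r -aa; ring.
Qed.

Definition theta (c : int -> int) (e : int -> nat) n : {poly int} :=
  \sum_(j <- sym_range n) ((-1) ^+ `|j|%N * (c j)%:~R) * 'X^(e j).

(** The indices j and -1 - j give equal terms, so summing over all integers doubles the usual series
    over j >= 0; hence the factor 2. *)
Lemma jacobi_cube K n r (e : int -> nat) : (0 < r)%N -> (2 * K <= n)%N ->
  (forall j, 2 * (e j)%:Z = r%:Z * j * (j + 1)) ->
  eqX K (2 * f_trunc r n ^+ 3) (theta (fun j => 2 * j + 1) e n).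
Proof.
move=> r0 Kn eE; pose g (j : int) := (`|n%:Z - j|%N, absz (n%:Z + j + 1)).
have -> : 2 * f_trunc r n ^+ 3 = f_trunc r n * (2 * f_trunc r n ^+ 2) by ring.
have eK (j : int) : (K < absz (j + 1)%R)%N \/ (K < absz j)%N -> (K <= e j)%N.
  by move=> h; have := eE j; nia.
apply: eqX_trans (theta_limit (g := g) _ r0 _ _); last 2 first.
- lia.
- move=> j ej; have := eK j; rewrite /g /=; lia.
(* The term k = 2 n + 1 has index - n - 1, outside [sym_range n]; it is split off and vanishes
   modulo 'X^K. *)
rewrite (finite_jacobi_cube n eE) big_ord_recr /= mulrDr.
rewrite -[X in eqX _ _ X]addr0; apply: eqXD; last first.
  rewrite mulrA mulrC -[X in eqX _ _ X](mulr0 'X^(e (n%:Z - (2 * n + 1)%:Z))).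
  by apply: eqX_exp0; apply: eK; lia.
apply: eqXMl; rewrite (reindex_inj rev_ord_inj) /=.
have -> : \sum_(j <- sym_range n) (-1) ^+ `|j|%N * (2 * j + 1)%:~R *
    gbin 'X^r ((g j).1 + (g j).2) (g j).1 * 'X^(e j) =
  \sum_(j <- sym_range n) (-1) ^+ `|j|%N * (2 * j + 1)%:~R *
    gbin 'X^r (2 * n + 1) `|n%:Z - j|%N * 'X^(e j) :> {poly int}.
  rewrite big_seq [RHS]big_seq; apply: eq_bigr => j; rewrite mem_sym_range => jn.
  by congr (_ * gbin _ _ _ * _); rewrite /g /=; lia.
rewrite big_sym_range; apply/eqX_coefP => i _; congr (polyseq _)`_i.
apply: eq_bigr => k _; have kn := ltn_ord k.
have -> : n%:Z - (2 * n + 1 - k.+1)%N%:Z = k%:Z - n%:Z by lia.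
by congr (_ * gbin _ _ _ * _); lia.
Qed.

Lemma f_truncS r n : f_trunc r n.+1 = f_trunc r n * (1 - 'X^(r * n.+1)).
Proof. by rewrite /f_trunc big_nat_recr. Qed.

(** If |j| >= K the exponent is at least K; if |j| < K then 2 K <= n keeps n + j and n - j at least
    K. So [theta_limit] applies. *)
Lemma triple_product K n t u (e : int -> nat) : (0 < t)%N -> (0 < u)%N -> (2 * K <= n)%N ->
  (forall j, 2 * (e j)%:Z = t%:Z * j * (j + 1) + u%:Z * j * (j - 1)) ->
  eqX K (f_trunc (t + u) n * (\prod_(i < n) (1 - 'X^((t + u) * i + t)) *
                              \prod_(i < n) (1 - 'X^((t + u) * i + u))))
        (theta (fun=> 1) e n).
Proof.
move=> t0 u0 Kn eE; case: (posnP n) Kn => [-> K0|n0 Kn].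
  by apply/eqX_coefP => i iK; lia.
pose g (j : int) := (absz (n%:Z + j), absz (n%:Z - j)).
have eK (j : int) : (K <= absz j)%N -> (K <= e j)%N.
  by move=> h; have := eE j; nia.
rewrite (finite_triple_product n0 eE).
apply: eqX_trans (theta_limit (g := g) _ (r := t + u) _ _ _); last 3 first.
- lia.
- lia.
- by move=> j ej; have := eK j; rewrite /g /=; lia.
apply/eqX_coefP => i _; congr (polyseq (_ * _))`_i.
rewrite big_seq [RHS]big_seq; apply: eq_bigr => j; rewrite mem_sym_range => jn.
by rewrite mulr1; congr (_ * gbin _ _ _ * _); rewrite /g /=; lia.
Qed.

(** With t = u = 1 the triple product gives phi = f_2 O^2, where O is the product of the 1 - q^(2 i
    + 1); and f_1 = f_2 O. *)
Lemma gauss_square K n (e : int -> nat) : (2 * K <= n)%N ->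
  (forall j, (e j)%:Z = j * j) ->
  eqX K (f_trunc 1 n ^+ 2) (theta (fun=> 1) e n * f_trunc 2 n).
Proof.
move=> Kn eE.
(* Truncating at 2 n makes the split into n even and n odd exponents exact. *)
apply: (@eqX_trans _ (f_trunc 1 (2 * n) ^+ 2)).
  by apply: eqX_exp; apply: f_trunc_eqX => //; lia.
have -> : f_trunc 1 (2 * n) = f_trunc 2 n * \prod_(i < n) (1 - 'X^((1 + 1) * i + 1)).
  rewrite -(big_mkord xpredT (fun i => 1 - 'X^((1 + 1) * i + 1))).
  elim: (n) => [|m IH]; first by rewrite muln0 /f_trunc !big_geq // mulr1.
  have -> : (2 * m.+1 = (2 * m).+2)%N by lia.
  rewrite !f_truncS IH big_nat_recr //=.
  have -> : (1 * (2 * m).+1 = (1 + 1) * m + 1)%N by lia.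
  have -> : (1 * (2 * m).+2 = 2 * m.+1)%N by lia.
  ring.
have := @triple_product K n 1 1 e isT isT Kn.
set O := \prod_(i < n) _; move=> h.
have -> : (f_trunc 2 n * O) ^+ 2 = (f_trunc (1 + 1) n * (O * O)) * f_trunc 2 n by ring.
by apply: eqXMr; apply: h => j; rewrite eE; ring.
Qed.

(** The triple product with t = 2 and u = 4: the exponents of f_2 split modulo 6 into 6 i + 2, 6 i +
    4 and 6 i + 6. *)
Lemma euler_pentagonal K n (e : int -> nat) : (2 * K <= n)%N ->
  (forall j, (e j)%:Z = 3 * j * j - j) ->
  eqX K (f_trunc 2 n) (theta (fun=> 1) e n).
Proof.
move=> Kn eE; apply: (@eqX_trans _ (f_trunc 2 (3 * n))).
  by apply: f_trunc_eqX => //; lia.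
have -> : f_trunc 2 (3 * n) = f_trunc (2 + 4) n * (\prod_(i < n) (1 - 'X^((2 + 4) * i + 2)) *
                              \prod_(i < n) (1 - 'X^((2 + 4) * i + 4))).
  rewrite -(big_mkord xpredT (fun i => 1 - 'X^((2 + 4) * i + 2))).
  rewrite -(big_mkord xpredT (fun i => 1 - 'X^((2 + 4) * i + 4))).
  elim: (n) => [|m IH]; first by rewrite muln0 /f_trunc !big_geq // !mulr1.
  have -> : (3 * m.+1 = (3 * m).+3)%N by lia.
  rewrite !f_truncS IH !(big_nat_recr m) //=.
  have -> : (2 * (3 * m).+1 = (2 + 4) * m + 2)%N by lia.
  have -> : (2 * (3 * m).+2 = (2 + 4) * m + 4)%N by lia.
  have -> : (2 * (3 * m).+3 = (2 + 4) * m.+1)%N by lia.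
  ring.
by apply: triple_product => // j; rewrite eE; ring.
Qed.

(** * The rotation of the Eisenstein lattice *)

(** When [P] is [boxed], this lists all its integer solutions, so bijections between solution sets
    become permutations of finite lists. *)
Definition lattice_pts n (P : pred (int * int)) : seq (int * int) :=
  [seq p <- [seq (a, b) | a <- sym_range n, b <- sym_range n] | P p].

Definition boxed n (P : pred (int * int)) :=
  forall p, P p -> (`|p.1| <= n)%N && (`|p.2| <= n)%N.

Lemma mem_lattice_pts n P p : boxed n P -> (p \in lattice_pts n P) = P p.
Proof.
move=> bP; rewrite mem_filter; case: (boolP (P p)) => //= /bP /andP[p1 p2].
by apply/allpairsP; exists p; rewrite !mem_sym_range -surjective_pairing.
Qed.

Lemma lattice_pts_uniq n P : uniq (lattice_pts n P).
Proof.
apply: filter_uniq; apply: allpairs_uniq; try exact: sym_range_uniq.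
by move=> [a b] [c d] _ _ /= [-> ->].
Qed.

Lemma lattice_pts_reindex (R : nmodType) n (P Q : pred (int * int)) f g (F : int * int -> R) :
  boxed n P -> boxed n Q ->
  (forall p, P p -> Q (f p) /\ g (f p) = p) ->
  (forall p, Q p -> P (g p) /\ f (g p) = p) ->
  \sum_(p <- lattice_pts n Q) F p = \sum_(p <- lattice_pts n P) F (f p).
Proof.
move=> bP bQ PQ QP; rewrite -(big_map f xpredT F); apply: perm_big.
apply: uniq_perm; first exact: lattice_pts_uniq.
  rewrite map_inj_in_uniq ?lattice_pts_uniq // => p q; rewrite !mem_lattice_pts // => Pp Pq fpq.
  by rewrite -(PQ p Pp).2 -(PQ q Pq).2 fpq.
move=> p; rewrite mem_lattice_pts //; apply/idP/mapP => [Qp|[q]].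
  by exists (g p); rewrite ?mem_lattice_pts; case: (QP p Qp).
by rewrite mem_lattice_pts // => Pq ->; case: (PQ q Pq).
Qed.

Lemma lattice_pts_split (R : nmodType) n (P Q : pred (int * int)) (F : int * int -> R) :
  \sum_(p <- lattice_pts n P) F p = \sum_(p <- lattice_pts n (fun p => P p && Q p)) F p
     + \sum_(p <- lattice_pts n (fun p => P p && ~~ Q p)) F p.
Proof.
by rewrite !big_filter (bigID Q) /=.
Qed.

Lemma coef_theta_mul c c' e e' n i :
  (theta c e n * theta c' e' n)`_i =
  \sum_(p <- lattice_pts n (fun p => (e p.1 + e' p.2)%N == i))
    (if (2 %| p.1 + p.2)%Z then c p.1 * c' p.2 else - (c p.1 * c' p.2)).
Proof.
rewrite /theta big_distrlr /= coef_sum [RHS]big_filter [RHS]big_mkcond [RHS]big_allpairs.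
apply: eq_bigr => a _; rewrite coef_sum; apply: eq_bigr => b _ /=.
have -> : (-1) ^+ `|a| * (c a)%:~R * 'X^(e a) * ((-1) ^+ `|b| * (c' b)%:~R * 'X^(e' b)) =
   ((-1) ^+ (`|a| + `|b|) * c a * c' b)%:P * 'X^(e a + e' b) :> {poly int}.
  rewrite !polyCM !exprD rmorphM !rmorphXn rmorphN1; ring.
rewrite coefCM coefXn eq_sym -signr_odd.
have -> : odd (`|a| + `|b|) = ~~ (2 %| a + b)%Z by lia.
by case: eqP => _; case: (2 %| _)%Z; rewrite /= ?mulr0 // ?expr0 ?expr1 mulr1; ring.
Qed.

(** Three times this exponent plus 1 is (3 k + 1)^2. The integer inside [absz] is never negative. *)
Definition quintuple_exp (k : int) : nat := absz (3 * k * k + 2 * k).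

Lemma quintuple_expE k : (quintuple_exp k)%:Z = 3 * k * k + 2 * k.
Proof. rewrite /quintuple_exp; nia. Qed.

Lemma absz_le_sqr (y : int) : (absz y)%:Z <= y * y.
Proof. case: y => n; nia. Qed.

Lemma absz_le_quintuple (y : int) : (absz y)%:Z <= 3 * y * y + 2 * y.
Proof. by case: y => n; rewrite ?NegzE; nia. Qed.

Lemma absz_le_pentagonal (y : int) : (absz y)%:Z <= 3 * y * y - y.
Proof. by case: y => n; rewrite ?NegzE; nia. Qed.

Lemma absz_le_pronic (y : int) : (absz y)%:Z <= y * (y + 1) + 1.
Proof. by case: y => n; rewrite ?NegzE; nia. Qed.

Section Rotation.
Variables (n N : nat).
Hypothesis Nn : (N < n)%N.

(** Norm equations: with x = 3 p.1 + 1, [P] says x^2 + 3 p.2^2 = 3 N + 1; with X = 6 p.2 - 1 and Y =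
    2 p.1 + 1, [Q] says (X^2 + 3 Y^2) / 4 = 3 N + 1. *)
Let P (p : int * int) := 3 * p.1 * p.1 + 2 * p.1 + p.2 * p.2 == N%:Z.
Let Q (p : int * int) := p.1 * (p.1 + 1) + (3 * p.2 * p.2 - p.2) == N%:Z.
Let even (p : int * int) := (2 %| p.1 + p.2)%Z.
Let Pe p := P p && even p.
Let Po p := P p && ~~ even p.
Let Qe p := Q p && even p.
Let Qo p := Q p && ~~ even p.

Lemma boxedP : boxed n P.
Proof.
move=> [k y]; rewrite /P /= => /eqP h.
by have := absz_le_sqr y; have := absz_le_quintuple k; lia.
Qed.

Lemma boxedQ : boxed n Q.
Proof.
move=> [j b]; rewrite /Q /= => /eqP h.
by have := absz_le_pronic j; have := absz_le_pentagonal b; lia.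
Qed.

Lemma boxed_and (A B : pred (int * int)) : boxed n A -> boxed n (fun p => A p && B p).
Proof. by move=> bA p /andP[/bA]. Qed.

(** The reflection y -> - y makes the sum its own opposite. *)
Lemma sum_snd0 (A : pred (int * int)) : boxed n A ->
  (forall k y, A (k, y) -> A (k, - y)) -> \sum_(p <- lattice_pts n A) p.2 = 0.
Proof.
move=> bA AN; suff : \sum_(p <- lattice_pts n A) p.2 = - \sum_(p <- lattice_pts n A) p.2 by lia.
pose f (p : int * int) := (p.1, - p.2).
have Af p : A p -> A (f p) /\ f (f p) = p.
  by case: p => k y /AN Aky; rewrite /f /= opprK.
by rewrite [LHS](lattice_pts_reindex _ bA bA Af Af) sumrN.
Qed.

(* f multiplies 3 k + 1 + y sqrt(-3) by a cube root of unity; the real parts over an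
   orbit add up to 0. *)
Lemma Po_sum : \sum_(p <- lattice_pts n Po) (3 * p.1 + 1) = 0.
Proof.
pose f (p : int * int) := (- ((p.1 + p.2 + 1) %/ 2)%Z, ((3 * p.1 + 1 - p.2) %/ 2)%Z).
pose g (p : int * int) := (((p.2 - p.1 - 1) %/ 2)%Z, - ((3 * p.1 + 1 + p.2) %/ 2)%Z).
have Pf p : Po p -> Po (f p) /\ g (f p) = p.
  case: p => k y; rewrite /Po /P /even /= => /andP[/eqP h e]; rewrite /f /g /=.
  have [a ka] : exists a, y = 2 * a - k - 1 by exists ((y + k + 1) %/ 2)%Z; lia.
  have -> : ((k + y + 1) %/ 2)%Z = a by lia.
  have -> : ((3 * k + 1 - y) %/ 2)%Z = 2 * k + 1 - a by lia.
  split; last by congr (_, _); lia.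
  by apply/andP; split; [apply/eqP; rewrite -h ka; ring | lia].
have Pg p : Po p -> Po (g p) /\ f (g p) = p.
  case: p => k y; rewrite /Po /P /even /= => /andP[/eqP h e]; rewrite /f /g /=.
  have [a ka] : exists a, y = 2 * a + k + 1 by exists ((y - k - 1) %/ 2)%Z; lia.
  have -> : ((y - k - 1) %/ 2)%Z = a by lia.
  have -> : ((3 * k + 1 + y) %/ 2)%Z = 2 * k + 1 + a by lia.
  split; last by congr (_, _); lia.
  by apply/andP; split; [apply/eqP; rewrite -h ka; ring | lia].
have bPo : boxed n Po by exact/boxed_and/boxedP.
(* With x = 3 k + 1, the rotated real part is - (x + 3 y) / 2, and the y sum to 0; so twice the sum
   is its opposite. *)
suff : 2 * \sum_(p <- lattice_pts n Po) (3 * p.1 + 1) =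
       - \sum_(p <- lattice_pts n Po) (3 * p.1 + 1) - 3 * \sum_(p <- lattice_pts n Po) p.2.
  rewrite (sum_snd0 bPo); first by lia.
  move=> k y; rewrite /Po /P /even /= => /andP[/eqP h e].
  by apply/andP; split; [apply/eqP; rewrite -h; ring | lia].
rewrite {1}(lattice_pts_reindex _ bPo bPo Pf Pg) !mulr_sumr -!sumrN -big_split /=.
rewrite big_seq [RHS]big_seq; apply: eq_bigr => -[k y].
by rewrite mem_lattice_pts // /Po /P /even /f /= => /andP[_ e]; lia.
Qed.

(** The map j -> -1 - j preserves [Q], flips the parity of j + b and negates 2 j + 1. *)
Lemma Qo_sum :
  \sum_(p <- lattice_pts n Qo) (2 * p.1 + 1) = - \sum_(p <- lattice_pts n Qe) (2 * p.1 + 1).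
Proof.
pose f (p : int * int) := (- 1 - p.1, p.2).
have Qf p : Qe p -> Qo (f p) /\ f (f p) = p.
  case: p => k y; rewrite /Qo /Qe /Q /even /f /= => /andP[/eqP h e].
  split; last by congr (_, _); lia.
  by apply/andP; split; [apply/eqP; rewrite -h; ring | lia].
have Qg p : Qo p -> Qe (f p) /\ f (f p) = p.
  case: p => k y; rewrite /Qo /Qe /Q /even /f /= => /andP[/eqP h e].
  split; last by congr (_, _); lia.
  by apply/andP; split; [apply/eqP; rewrite -h; ring | lia].
rewrite (lattice_pts_reindex _ _ _ Qf Qg); try exact/boxed_and/boxedQ.
by rewrite -sumrN; apply: eq_bigr => p _ /=; ring.
Qed.

(* With x = 3 k + 1, (j, b) = f (k, y) means that x + y sqrt(-3) times a cube root of
   unity is (X + Y sqrt(-3)) / 2 for X = 6 b - 1 and Y = 2 j + 1. *)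
Lemma Qe_sum :
  \sum_(p <- lattice_pts n Qe) (2 * p.1 + 1) = \sum_(p <- lattice_pts n Pe) (3 * p.1 + 1).
Proof.
pose f (p : int * int) := (((3 * p.1 - p.2) %/ 2)%Z, - ((p.1 + p.2) %/ 2)%Z).
pose g (p : int * int) := (((p.1 - p.2) %/ 2)%Z, - ((p.1 + 3 * p.2) %/ 2)%Z).
have PQ p : Pe p -> Qe (f p) /\ g (f p) = p.
  case: p => k y; rewrite /Pe /P /Qe /Q /even /= => /andP[/eqP h e]; rewrite /f /g /=.
  have [a ka] : exists a, y = 2 * a - k by exists ((y + k) %/ 2)%Z; lia.
  have -> : ((k + y) %/ 2)%Z = a by lia.
  have -> : ((3 * k - y) %/ 2)%Z = 2 * k - a by lia.
  split; last by congr (_, _); lia.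
  by apply/andP; split; [apply/eqP; rewrite -h ka; ring | lia].
have QP p : Qe p -> Pe (g p) /\ f (g p) = p.
  case: p => k y; rewrite /Pe /P /Qe /Q /even /= => /andP[/eqP h e]; rewrite /f /g /=.
  have [a ka] : exists a, k = 2 * a + y by exists ((k - y) %/ 2)%Z; lia.
  have -> : ((k - y) %/ 2)%Z = a by lia.
  have -> : ((k + 3 * y) %/ 2)%Z = a + 2 * y by lia.
  split; last by congr (_, _); lia.
  by apply/andP; split; [apply/eqP; rewrite -h ka; ring | lia].
have bPe : boxed n Pe by exact/boxed_and/boxedP.
rewrite (lattice_pts_reindex _ _ _ PQ QP) //; last exact/boxed_and/boxedQ.
(* On the image 2 j + 1 = 3 k + 1 - y, so the two sums differ by the sum of the y. *)
have Pe0 : \sum_(p <- lattice_pts n Pe) p.2 = 0.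
  apply: sum_snd0 => // k y; rewrite /Pe /P /even /= => /andP[/eqP h e].
  by apply/andP; split; [apply/eqP; rewrite -h; ring | lia].
rewrite -[RHS]subr0 -[X in _ - X]Pe0 -sumrB.
rewrite big_seq [RHS]big_seq; apply: eq_bigr => -[k y].
by rewrite mem_lattice_pts // /Pe /P /even /f /= => /andP[_ e]; lia.
Qed.

(** On the left the odd points double the even ones, on the right they contribute 0, and the even
    parts agree by [Qe_sum]. *)
Lemma rotation_sum :
  \sum_(p <- lattice_pts n Q) (if even p then 2 * p.1 + 1 else - (2 * p.1 + 1)) =
  2 * \sum_(p <- lattice_pts n P) (if even p then 3 * p.1 + 1 else - (3 * p.1 + 1)).
Proof.
have split_sign (A : pred (int * int)) (F : int * int -> int) :
    \sum_(p <- lattice_pts n A) (if even p then F p else - F p) =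
    \sum_(p <- lattice_pts n (fun p => A p && even p)) F p
    - \sum_(p <- lattice_pts n (fun p => A p && ~~ even p)) F p.
  rewrite (lattice_pts_split _ _ even) -sumrN !big_filter; congr (_ + _);
    by apply: eq_bigr => p /andP[_ e]; rewrite ?e ?(negbTE e).
rewrite !split_sign -/Qe -/Qo -/Pe -/Po Qo_sum Qe_sum Po_sum; ring.
Qed.
End Rotation.

(** The coefficient form of 2 f_2^3 f_2 = 2 G phi; K <= n puts all representations of each i < K in
    the box. *)
Lemma theta_rotation K n (ec ep eg : int -> nat) : (K <= n)%N ->
  (forall j, (ec j)%:Z = j * (j + 1)) -> (forall j, (ep j)%:Z = 3 * j * j - j) ->
  (forall j, (eg j)%:Z = j * j) ->
  eqX K (theta (fun j => 2 * j + 1) ec n * theta (fun=> 1) ep n)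
        (2 * (theta (fun k => 3 * k + 1) quintuple_exp n * theta (fun=> 1) eg n)).
Proof.
move=> Kn ecE epE egE; apply/eqX_coefP => i iK.
have -> : 2 = 2%:P :> {poly int} by rewrite rmorph_nat.
rewrite coefCM !coef_theta_mul.
transitivity (\sum_(p <- lattice_pts n (fun p => p.1 * (p.1 + 1) + (3 * p.2 * p.2 - p.2) == i%:Z))
    (if (2 %| p.1 + p.2)%Z then 2 * p.1 + 1 else - (2 * p.1 + 1))).
  apply: congr_big => [|//|p _]; last by rewrite mulr1.
  by apply: eq_filter => p; rewrite -[LHS]eqz_nat PoszD ecE epE.
rewrite (rotation_sum (leq_trans iK Kn)); congr (_ * _).
apply: congr_big => [|//|p _]; last by rewrite mulr1.
by apply: eq_filter => p; rewrite -[RHS]eqz_nat PoszD quintuple_expE egE.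
Qed.

(** * The quintuple product and the congruence *)

Definition square_exp (j : int) : nat := absz (j * j).

Lemma square_expE j : (square_exp j)%:Z = j * j.
Proof. by rewrite /square_exp; have := absz_le_sqr j; lia. Qed.

Definition quintuple n := theta (fun k => 3 * k + 1) quintuple_exp n.

Lemma eqX_cancel2 K p q : eqX K (2 * p) (2 * q) -> eqX K p q.
Proof.
have E : 2 = 2%:P :> {poly int} by rewrite rmorph_nat.
move=> /eqX_coefP h; apply/eqX_coefP => i /h; rewrite E !coefCM; lia.
Qed.

(** Multiply 2 f_2^4 = 2 G phi by f_2, use phi f_2 = f_1^2, and cancel 2. *)
Lemma quintuple_product K n : (2 * K <= n)%N ->
  eqX K (f_trunc 2 n ^+ 5) (quintuple n * f_trunc 1 n ^+ 2).
Proof.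
move=> Kn.
pose ec (j : int) := absz (j * (j + 1))%R; pose ep (b : int) := absz (3 * b * b - b)%R.
have ecE (j : int) : (ec j)%:Z = j * (j + 1).
  by rewrite /ec; have := absz_le_pronic j; lia.
have epE (j : int) : (ep j)%:Z = 3 * j * j - j.
  by rewrite /ep; have := absz_le_pentagonal j; lia.
have cube : eqX K (2 * f_trunc 2 n ^+ 3) (theta (fun j => 2 * j + 1) ec n).
  by apply: jacobi_cube => // j; rewrite ecE; ring.
have pent := euler_pentagonal Kn epE.
have gauss := gauss_square Kn square_expE.
have rot : eqX K _ _ := theta_rotation (_ : K <= n)%N ecE epE square_expE.
have {}rot := rot ltac:(lia).
apply: eqX_cancel2.
set phi := theta _ square_exp n in gauss rot; rewrite /quintuple.
set G := theta _ quintuple_exp n in rot *.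
have -> : 2 * f_trunc 2 n ^+ 5 = 2 * f_trunc 2 n ^+ 3 * f_trunc 2 n * f_trunc 2 n by ring.
apply: (@eqX_trans _ (2 * (G * phi) * f_trunc 2 n)).
  by apply: eqXMr; apply: eqX_trans rot; apply: eqXM.
have -> : 2 * (G * phi) * f_trunc 2 n = 2 * G * (phi * f_trunc 2 n) by ring.
by rewrite [2 * (G * _)]mulrA; apply: eqXMl; apply: eqX_sym.
Qed.

Lemma eqX_comp_oppX K p q : eqX K p q -> eqX K (p \Po - 'X) (q \Po - 'X).
Proof.
case=> r ->; exists ((-1) ^+ K * (r \Po - 'X)).
by rewrite comp_polyD comp_polyM comp_Xn_poly (exprNn 'X) [in RHS]mulrCA mulrA.
Qed.

Lemma f_trunc_comp r n p : f_trunc r n \Po p = \prod_(1 <= i < n.+1) (1 - p ^+ (r * i)).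
Proof.
rewrite /f_trunc rmorph_prod; apply: eq_bigr => i _.
by rewrite rmorphB rmorph1 /= comp_Xn_poly.
Qed.

Lemma f_trunc_even_oppX r n : ~~ odd r -> f_trunc r n \Po - 'X = f_trunc r n.
Proof.
move=> ev; rewrite f_trunc_comp; apply: eq_bigr => i _.
by rewrite (exprNn 'X) -signr_odd oddM (negbTE ev) mul1r.
Qed.

Lemma f_trunc_mulX r s n : f_trunc r n \Po 'X^s = f_trunc (s * r) n.
Proof. by rewrite f_trunc_comp; apply: eq_bigr => i _; rewrite -exprM mulnA. Qed.

(** Odd exponents pair as (1 - x) (1 + x) = 1 - x^2, which with f_4 rebuilds f_2; even exponents
    occur twice and give f_2^2. [E] is the exact finite version. *)
Lemma f_trunc1_mul_oppX K n : (K <= n)%N ->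
  eqX K (f_trunc 1 n * (f_trunc 1 n \Po - 'X) * f_trunc 4 n) (f_trunc 2 n ^+ 3).
Proof.
move=> Kn.
have E : f_trunc 1 (2 * n) * (f_trunc 1 (2 * n) \Po - 'X) * f_trunc 4 n =
         f_trunc 2 n ^+ 2 * f_trunc 2 (2 * n).
  rewrite f_trunc_comp -/(f_trunc 1 _).
  elim: (n) => [|m IH]; first by rewrite muln0 /f_trunc !big_geq // !mulr1.
  have -> : (2 * m.+1 = (2 * m).+2)%N by lia.
  rewrite !f_truncS !(big_nat_recr (2 * m).+2) // (big_nat_recr (2 * m).+1) //=.
  set A := f_trunc 1 _ in IH *; set B := \prod_(1 <= i < (2 * m).+1) _ in IH *.
  set a := f_trunc 4 m in IH *; set b := f_trunc 2 m in IH *; set c := f_trunc 2 (2 * m) in IH *.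
  rewrite !(exprNn 'X) -[(-1) ^+ (1 * _)]signr_odd -[(-1) ^+ (1 * (2 * m).+2)]signr_odd.
  have -> : odd (1 * (2 * m).+1) by lia.
  have -> : odd (1 * (2 * m).+2) = false by lia.
  rewrite expr1 expr0 !mul1n mul1r mulN1r opprK; set x : {poly int} := 'X^((2 * m).+1).
  have -> : 'X^(2 * (2 * m).+1) = x * x :> {poly int} by rewrite -exprD; congr 'X^_; lia.
  have -> : 'X^(2 * m.+1) = 'X^((2 * m).+2) :> {poly int} by congr 'X^_; lia.
  have -> : 'X^(4 * m.+1) = 'X^(2 * (2 * m).+2) :> {poly int} by congr 'X^_; lia.
  set y := 'X^((2 * m).+2); set z := 'X^(2 * _).
  transitivity (A * B * a * ((1 - x) * (1 - y) * (1 + x) * (1 - y) * (1 - z))); first by ring.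
  rewrite IH; ring.
have e1 : eqX K (f_trunc 1 n) (f_trunc 1 (2 * n)) by apply: f_trunc_eqX; lia.
apply: (@eqX_trans _ (f_trunc 2 n ^+ 2 * f_trunc 2 (2 * n))).
  by rewrite -E; apply: eqXMr; apply: eqXM => //; apply: eqX_comp_oppX.
rewrite [X in eqX _ _ X]exprSr; apply: eqXMl.
by apply: f_trunc_eqX => //; lia.
Qed.

(** Multiplying the quintuple identities at q and - q and then by f_4^2 gives f_2^10 f_4^2 = f_2^6
    G(q) G(- q); f_2^6 cancels. *)
Lemma quintuple_mul_oppX K n : (2 * K <= n)%N ->
  eqX K (quintuple n * (quintuple n \Po - 'X)) (f_trunc 2 n ^+ 4 * f_trunc 4 n ^+ 2).
Proof.
move=> Kn; have q1 := quintuple_product Kn.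
have := eqX_comp_oppX q1.
rewrite (rmorphXn (comp_poly _)) comp_polyM (rmorphXn (comp_poly _)) /= f_trunc_even_oppX // => q2.
have := f_trunc1_mul_oppX (_ : K <= n)%N => /(_ ltac:(lia)) q3.
set G := quintuple n in q1 q2 *; set G' := G \Po - 'X in q2 *.
set F1 := f_trunc 1 n in q1 q2 q3; set F1' := F1 \Po - 'X in q2 q3.
set F2 := f_trunc 2 n in q1 q2 q3 *; set F4 := f_trunc 4 n in q3 *.
apply: (@eqX_mulI _ (F2 ^+ 6)).
  by rewrite -horner_coef0 horner_exp horner_coef0 f_trunc0 // expr1n.
have -> : F2 ^+ 6 * (F2 ^+ 4 * F4 ^+ 2) = F2 ^+ 5 * F2 ^+ 5 * F4 ^+ 2 by ring.
apply: eqX_sym; apply: (@eqX_trans _ (G * F1 ^+ 2 * (G' * F1' ^+ 2) * F4 ^+ 2)).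
  by apply: eqXMr; apply: eqXM.
have -> : G * F1 ^+ 2 * (G' * F1' ^+ 2) * F4 ^+ 2 = (F1 * F1' * F4) ^+ 2 * (G * G') by ring.
have -> : F2 ^+ 6 = (F2 ^+ 3) ^+ 2 by ring.
by apply: eqXMr; apply: eqX_exp.
Qed.

Lemma dvd11_sum_sqr (a b : int) : (11 %| a * a + b * b)%Z -> (11 %| a)%Z.
Proof.
have aE := divz_eq a 11; have bE := divz_eq b 11.
have r11 (c : int) : exists2 r : nat, (c %% 11)%Z = r & r \in iota 0 11.
  by exists (absz (c %% 11)%Z); [|rewrite mem_iota]; lia.
have [r rE ri] := r11 a; have [s sE si] := r11 b.
rewrite aE bE rE sE => h.
have {}h : (11 %| r * r + s * s)%N.
  suff : (11 %| r%:Z * r%:Z + s%:Z * s%:Z)%Z by lia.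
  set x := (a %/ 11)%Z in h; set y := (b %/ 11)%Z in h.
  have -> : r%:Z * r%:Z + s%:Z * s%:Z = (x * 11 + r%:Z) * (x * 11 + r%:Z) +
     (y * 11 + s%:Z) * (y * 11 + s%:Z) -
     11 * (11 * x * x + 2 * x * r%:Z + 11 * y * y + 2 * y * s%:Z) by ring.
  by rewrite rpredB // dvdz_mulr.
suff : (11 %| r)%N by lia.
(* All 121 pairs of residues are checked by computation. *)
have : all (fun r => all (fun s => (11 %| r * r + s * s)%N ==> (11 %| r)%N)
  (iota 0 11)) (iota 0 11).
  by vm_compute.
by move/allP/(_ _ ri)/allP/(_ _ si)/implyP; apply.
Qed.

Lemma quintuple_oppX n : quintuple n \Po - 'X =
  theta (fun k => (3 * k + 1) * (-1) ^+ quintuple_exp k) quintuple_exp n.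
Proof.
rewrite /quintuple /theta rmorph_sum /=; apply: eq_bigr => k _.
have polyC_int (z : int) : z%:~R = z%:P :> {poly int} by rewrite -[z in RHS]intz rmorph_int.
have polyC_sign m : (-1) ^+ m = ((-1) ^+ m)%:P :> {poly int} by rewrite rmorphXn rmorphN1.
rewrite comp_polyM comp_Xn_poly (exprNn 'X) !polyC_int !polyC_sign -!polyCM comp_polyC.
by rewrite !mulrA -polyCM.
Qed.

Lemma dvd11_coef_quintuple n m :
  (11 %| (quintuple n * (quintuple n \Po - 'X))`_(2 * (11 * m + 7)))%Z.
Proof.
rewrite quintuple_oppX /quintuple coef_theta_mul.
rewrite big_filter; apply: (big_ind (fun z => (11 %| z)%Z)) => // [x y|[k l] /= h].
  exact: rpredD.
have {}h : (11 %| 3 * k + 1)%Z.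
  apply: (@dvd11_sum_sqr _ (3 * l + 1)).
  have := quintuple_expE k; have := quintuple_expE l; move: h; set u := quintuple_exp k.
  set v := quintuple_exp l => /eqP h hv hu.
  (* The exponents add up to 22 m + 14, and 3 (22 m + 14) + 2 = 11 (6 m + 4). *)
  have -> : (3 * k + 1) * (3 * k + 1) + (3 * l + 1) * (3 * l + 1) =
    3 * u%:Z + 3 * v%:Z + 2 by rewrite hu hv; ring.
  lia.
by case: ifP => _; rewrite ?rpredN dvdz_mulr.
Qed.

Lemma dvd11_coef_f1_f2 n m : (11 * m + 7 <= n)%N ->
  (11 %| (f_trunc 1 n ^+ 4 * f_trunc 2 n ^+ 2)`_(11 * m + 7))%Z.
Proof.
set i := (11 * m + 7)%N => ni.
(* K exceeds 2 i, the index reached after q -> q^2, and N = 2 K is what [quintuple_mul_oppX]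
   requires. *)
pose K := (2 * i).+1; pose N := (2 * K)%N.
have /eqX_coefP -> // : eqX i.+1 (f_trunc 1 n ^+ 4 * f_trunc 2 n ^+ 2)
                         (f_trunc 1 N ^+ 4 * f_trunc 2 N ^+ 2).
  by apply: eqXM; apply: eqX_exp; apply: f_trunc_eqX => //; rewrite /N /K; lia.
have -> : (f_trunc 1 N ^+ 4 * f_trunc 2 N ^+ 2)`_i =
   ((f_trunc 1 N ^+ 4 * f_trunc 2 N ^+ 2) \Po 'X^2)`_(2 * i).
  by rewrite coef_comp_poly_Xn // dvdn_mulr // mulKn.
rewrite comp_polyM !(rmorphXn (comp_poly _)) /= !f_trunc_mulX.
have /eqX_coefP <- : eqX K _ _ := quintuple_mul_oppX (leqnn N); last by rewrite /K.
exact: dvd11_coef_quintuple.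
Qed.

(** Factor by factor, the geometric sum telescopes to 1 - 'X^(i (N + 1)). *)
Lemma inv_f1_trunc_mul N : eqX N.+1 (inv_f1_trunc N * f_trunc 1 N) 1.
Proof.
rewrite /inv_f1_trunc /f_trunc -big_split /= big_nat.
apply: (big_ind (fun p => eqX N.+1 p 1)) => [|p q hp hq|i /andP[i1 _]].
- exact: eqX_refl.
- by rewrite -[1]mulr1; apply: eqXM.
rewrite mul1n big_mkord mulrC.
have -> : (1 - 'X^i) * \sum_(j < N.+1) 'X^(i * j) = 1 - 'X^(i * N.+1) :> {poly int}.
  rewrite exprM -[1 in RHS](expr1n _ N.+1) subrXX; congr (_ * _); apply: eq_bigr => j _.
  by rewrite expr1n mul1r exprM.
exists (- 'X^(i * N.+1 - N.+1)); rewrite mulrN -exprD subnKC //; nia.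
Qed.

Local Notation toF11 := (map_poly (intr : int -> 'F_11)).

(** In characteristic 11 the 11th power is a ring morphism, sending each monomial 'X^(i j) to 'X^(11
    i j). *)
Lemma inv_f1_trunc_Frobenius N :
  toF11 (inv_f1_trunc N) ^+ 11 = toF11 (inv_f1_trunc N) \Po 'X^11.
Proof.
have ch : 11 \in [pchar {poly 'F_11}] by rewrite pchar_poly pchar_Fp.
have -> : toF11 (inv_f1_trunc N) =
    \prod_(1 <= i < N.+1) \sum_(0 <= j < N.+1) 'X^(i * j).
  rewrite rmorph_prod; apply: eq_bigr => i _; rewrite rmorph_sum; apply: eq_bigr => j _.
  by rewrite /= map_polyXn.
rewrite -(pFrobenius_autE ch) (rmorph_prod (pFrobenius_aut ch)).
rewrite (rmorph_prod (comp_poly _)); apply: eq_bigr => i _.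
rewrite (rmorph_sum (pFrobenius_aut ch)) (rmorph_sum (comp_poly _)); apply: eq_bigr => j _.
by rewrite /= pFrobenius_autE comp_Xn_poly -!exprM mulnC.
Qed.

Theorem theorem3p1 : forall n : nat, (11 %| d 2 (11 * n + 7))%Z.
Proof.
move=> n; rewrite /d; set N := (11 * n + 7)%N; rewrite -[(3 * 2 + 1)%N]/7%N.
set F1 := f_trunc 1 N; set F2 := f_trunc 2 N; set I := inv_f1_trunc N.
pose A := F1 ^+ 4 * F2 ^+ 2.
(* Inserting (I F1)^4, which is 1 modulo 'X^(N + 1), raises the exponent of I from 7 to 11. *)
have /eqX_coefP -> // : eqX N.+1 (F2 ^+ 2 * I ^+ 7) (A * I ^+ 11).
  apply: eqX_sym; rewrite -[X in eqX _ _ X]mulr1.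
  have -> : A * I ^+ 11 = F2 ^+ 2 * I ^+ 7 * (I * F1) ^+ 4 by rewrite /A; ring.
  apply: eqXMl; rewrite -[X in eqX _ _ X](expr1n _ 4); apply: eqX_exp.
  exact: inv_f1_trunc_mul.
rewrite (dvdz_pcharf (pchar_Fp (isT : prime 11))) -coef_map rmorphM rmorphXn /=.
rewrite inv_f1_trunc_Frobenius coefM big1 // => -[j jN] _ /=.
(* Only j with 11 dividing N - j survive, that is j congruent to 7 modulo 11, where the coefficient
   of A vanishes modulo 11. *)
rewrite coef_comp_poly_Xn //; case: ifP => [/dvdnP[l lE]|_]; last by rewrite mulr0.
suff -> : (toF11 A)`_j = 0 by rewrite mul0r.
have jE : (j = 11 * (n - l) + 7)%N by rewrite /N in lE jN; lia.
rewrite coef_map /=; apply/eqP; rewrite -(dvdz_pcharf (pchar_Fp (isT : prime 11))) jE.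
by apply: dvd11_coef_f1_f2; rewrite /N; lia.
Qed.
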